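(* Let $a\ge 2$ be an integer and, for $n,k\ge 0$, let $\Delta_{n,k}$ be the number of vertices of $\Pi^a_n$ having exactly $k$ neighbors. Then, as formal power series, $$\sum_{n,k\ge 0}\Delta_{n,k}x^ny^k=\frac{1}{1-\left(2y+(a-2)y^2\right)x-\left(y-y^2+y^3\right)x^2}.$$
   Context: For integers $a\ge 1$ and $n\ge 0$, let $\mathcal{S}^a_n$ be the set of all words $\alpha_1\cdots\alpha_n$ of length $n$ over the alphabet $\{0,1,\dots,a\}$ such that the letter $a$ appears only immediately after a letter $0$ (so $\alpha_1\ne a$, and $\alpha_i=a$ implies $\alpha_{i-1}=0$). The metallic cube $\Pi^a_n$ is the simple graph with vertex set $\mathcal{S}^a_n$ in which two vertices $\alpha,\beta$ are adjacent if and only if $\sum_{k=1}^n|\alpha_k-\beta_k|=1$, i.e. one is obtained from the other by replacing a single letter $k$ by $k+1$, $0\le k\le a-1$. ($\Pi^a_0$ has a single vertex, the empty word, so $\Delta_{0,0}=1$.) *)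

(* Defs.v *)
From HB Require Import structures.
From mathcomp Require Import all_boot all_order all_algebra.
From mathcomp Require Import boolp.

Set Implicit Arguments.
Unset Strict Implicit.
Unset Printing Implicit Defensive.

Import GRing.Theory.
Local Open Scope ring_scope.

(** * The ring R[[x, y]] of formal power series *)

(* [FPS2 c] is the formal sum of the [c n k] x^n y^k over all n, k >= 0. *)
Record fps2 (R : Type) := FPS2 { fps2_coef : nat -> nat -> R }.

Lemma fps2P (R : Type) (f g : fps2 R) :
  (forall n k, fps2_coef f n k = fps2_coef g n k) -> f = g.
Proof.
case: f g => [f] [g] /= fg; congr FPS2.
by apply/funext => n; apply/funext => k.
Qed.

HB.instance Definition _ (R : Type) := gen_eqMixin (fps2 R).
HB.instance Definition _ (R : Type) := gen_choiceMixin (fps2 R).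

Section Fps2Ring.
Variable R : comNzRingType.
Implicit Types f g h : fps2 R.

Definition fps2_zero : fps2 R := FPS2 (fun _ _ => 0).
Definition fps2_opp f : fps2 R := FPS2 (fun n k => - fps2_coef f n k).
Definition fps2_add f g : fps2 R :=
  FPS2 (fun n k => fps2_coef f n k + fps2_coef g n k).

Lemma fps2_addA : associative fps2_add.
Proof. by move=> f g h; apply: fps2P => n k /=; rewrite addrA. Qed.
Lemma fps2_addC : commutative fps2_add.
Proof. by move=> f g; apply: fps2P => n k /=; rewrite addrC. Qed.
Lemma fps2_add0 : left_id fps2_zero fps2_add.
Proof. by move=> f; apply: fps2P => n k /=; rewrite add0r. Qed.
Lemma fps2_addN : left_inverse fps2_zero fps2_opp fps2_add.
Proof. by move=> f; apply: fps2P => n k /=; rewrite addNr. Qed.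

HB.instance Definition _ :=
  GRing.isZmodule.Build (fps2 R) fps2_addA fps2_addC fps2_add0 fps2_addN.

Definition fps2_one : fps2 R :=
  FPS2 (fun n k => ((n == 0%N) && (k == 0%N))%:R).
Definition fps2_mul f g : fps2 R :=
  FPS2 (fun n k => \sum_(i < n.+1) \sum_(j < k.+1)
    fps2_coef f i j * fps2_coef g (n - i) (k - j)).

(* Truncation to a polynomial, used to transfer the ring axioms from
   [{poly {poly R}}]. *)
Let trunc N f : {poly {poly R}} :=
  \poly_(i < N) \poly_(j < N) fps2_coef f i j.

Let coef_trunc N f n k : (n < N)%N -> (k < N)%N ->
  (trunc N f)`_n`_k = fps2_coef f n k.
Proof. by move=> nN kN; rewrite /trunc coef_poly nN coef_poly kN. Qed.

Let coef_mul2 (p q : {poly {poly R}}) n k : (p * q)`_n`_k =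
  \sum_(i < n.+1) \sum_(j < k.+1) p`_i`_j * q`_(n - i)`_(k - j).
Proof.
by rewrite coefM coef_sum; apply: eq_bigr => i _; rewrite coefM.
Qed.

Let mul_trunc N f g n k : (n < N)%N -> (k < N)%N ->
  (trunc N f * trunc N g)`_n`_k = fps2_coef (fps2_mul f g) n k.
Proof.
move=> nN kN; rewrite coef_mul2; apply: eq_bigr => i _; apply: eq_bigr => j _.
have le m (l : 'I_m.+1) : (m < N)%N -> (l < N)%N.
  by apply: leq_ltn_trans; rewrite -ltnS.
have ge m (l : 'I_m.+1) : (m < N)%N -> (m - l < N)%N.
  by apply: leq_ltn_trans; rewrite leq_subr.
by rewrite !coef_trunc ?le ?ge.
Qed.

Lemma fps2_mulC : commutative fps2_mul.
Proof.
move=> f g; apply: fps2P => n k; set N := (maxn n k).+1.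
have [nN kN] : (n < N)%N /\ (k < N)%N by rewrite !ltnS leq_maxl leq_maxr.
by rewrite -!(mul_trunc _ _ nN kN) mulrC.
Qed.

Lemma fps2_mulA : associative fps2_mul.
Proof.
move=> f g h; apply: fps2P => n k; set N := (maxn n k).+1.
have nN : (n < N)%N by rewrite ltnS leq_maxl.
have kN : (k < N)%N by rewrite ltnS leq_maxr.
have le m (l : 'I_m.+1) : (m < N)%N -> (l < N)%N.
  by apply: leq_ltn_trans; rewrite -ltnS.
have ge m (l : 'I_m.+1) : (m < N)%N -> (m - l < N)%N.
  by apply: leq_ltn_trans; rewrite leq_subr.
transitivity ((trunc N f * (trunc N g * trunc N h))`_n`_k).
  rewrite coef_mul2; apply: eq_bigr => i _; apply: eq_bigr => j _.
  by rewrite coef_trunc ?le // mul_trunc ?ge.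
rewrite mulrA coef_mul2; apply: eq_bigr => i _; apply: eq_bigr => j _.
by rewrite coef_trunc ?ge // mul_trunc ?le.
Qed.

Lemma fps2_mul1 : left_id fps2_one fps2_mul.
Proof.
move=> f; apply: fps2P => n k /=.
rewrite big_ord_recl big_ord_recl /= mul1r !subn0.
rewrite big1 ?addr0 => [|j _]; last by rewrite mul0r.
by rewrite big1 ?addr0 // => i _; rewrite big1 // => j _; rewrite mul0r.
Qed.

Lemma fps2_mulDl : left_distributive fps2_mul fps2_add.
Proof.
move=> f g h; apply: fps2P => n k /=.
rewrite -big_split; apply: eq_bigr => i _ /=.
by rewrite -big_split; apply: eq_bigr => j _ /=; rewrite mulrDl.
Qed.

Lemma fps2_oner_neq0 : fps2_one != 0.
Proof.
apply/eqP => /(congr1 (fun f => fps2_coef f 0 0)) /= /eqP.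
by rewrite oner_eq0.
Qed.

HB.instance Definition _ := GRing.Zmodule_isComNzRing.Build (fps2 R)
  fps2_mulA fps2_mulC fps2_mul1 fps2_mulDl fps2_oner_neq0.

Definition fps2_unit : pred (fps2 R) := fun f => `[< exists g, g * f = 1 >].

(* The inverse when there is one; as usual, [f^-1 = f] otherwise. *)
Definition fps2_inv f : fps2 R :=
  if pselect (exists g, g * f = 1) is left e then projT1 (cid e) else f.

Lemma fps2_mulVf : {in fps2_unit, left_inverse 1 fps2_inv *%R}.
Proof.
move=> f /asboolP fU; rewrite /fps2_inv.
by case: pselect => // e; case: (cid e).
Qed.

Lemma fps2_unitP f g : g * f = 1 -> fps2_unit f.
Proof. by move=> gf; apply/asboolP; exists g. Qed.

Lemma fps2_inv_out : {in [predC fps2_unit], fps2_inv =1 id}.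
Proof.
move=> f /asboolP fU; rewrite /fps2_inv.
by case: pselect => // e; case: fU.
Qed.

HB.instance Definition _ := GRing.ComNzRing_hasMulInverse.Build (fps2 R)
  fps2_mulVf fps2_unitP fps2_inv_out.

Definition fps2_x : fps2 R :=
  FPS2 (fun n k => ((n == 1%N) && (k == 0%N))%:R).
Definition fps2_y : fps2 R :=
  FPS2 (fun n k => ((n == 0%N) && (k == 1%N))%:R).

Lemma coef_fps2_xM f n k :
  fps2_coef (fps2_x * f) n k = if n is m.+1 then fps2_coef f m k else 0.
Proof.
transitivity (\sum_(i < n.+1) (if i == 1%N :> nat
    then fps2_coef f (n - i) k else 0)).
  apply: eq_bigr => i _; rewrite big_ord_recl big1 => [|j _].
    by rewrite addr0 /= andbT subn0; case: eqP => _; rewrite ?mul1r ?mul0r.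
  by rewrite /= andbF mul0r.
case: n => [|n]; first by rewrite big_ord1.
rewrite big_ord_recl add0r big_ord_recl big1 => [|i _] //.
by rewrite addr0 /= subSS subn0.
Qed.

Lemma coef_fps2_yM f n k :
  fps2_coef (fps2_y * f) n k = if k is l.+1 then fps2_coef f n l else 0.
Proof.
transitivity (\sum_(j < k.+1) (if j == 1%N :> nat
    then fps2_coef f n (k - j) else 0)).
  rewrite {1}/fps2_coef /= big_ord_recl [X in _ + X]big1 ?addr0 => [|i _].
    apply: eq_bigr => j _ /=; rewrite subn0.
    by case: eqP => _; rewrite ?mul1r ?mul0r.
  by rewrite big1 // => j _; rewrite mul0r.
case: k => [|k]; first by rewrite big_ord1.
rewrite big_ord_recl add0r big_ord_recl big1 => [|i _] //.
by rewrite addr0 /= subSS subn0.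
Qed.

(* Hence [FPS2 c] really is the formal sum of the [c n k] x^n y^k. *)
Lemma coef_fps2_monomial i j n k :
  fps2_coef (fps2_x ^+ i * fps2_y ^+ j) n k = ((n == i) && (k == j))%:R.
Proof.
elim: i n => [|i IHi] n; last first.
  by rewrite exprS -mulrA coef_fps2_xM; case: n => [|n].
rewrite expr0 mul1r; elim: j k => [|j IHj] k //.
by rewrite exprS coef_fps2_yM; case: k => [|k] //; rewrite andbF.
Qed.

End Fps2Ring.

Arguments fps2_x {R}.
Arguments fps2_y {R}.

(** * Metallic cubes *)

(* The words of length n over {0, ..., a} in which the letter a occurs only
   immediately after a letter 0. *)
Definition metallic_words (a n : nat) : {set n.-tuple 'I_a.+1} :=
  [set w : n.-tuple 'I_a.+1 | [forall i : 'I_n, (tnth w i == a :> nat) ==>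
    [exists j : 'I_n, (j.+1 == i :> nat) && (tnth w j == 0%N :> nat)]]].

Definition metallic_adj (a n : nat) : rel (n.-tuple 'I_a.+1) :=
  fun u v => \sum_(i < n) `|(tnth u i)%:Z - (tnth v i)%:Z| == 1.

(* The degree of u in the graph on [metallic_words a n]. *)
Definition metallic_deg (a n : nat) (u : n.-tuple 'I_a.+1) : nat :=
  #|[set v in metallic_words a n | metallic_adj u v]|.

(* The number of vertices of degree k of the metallic cube. *)
Definition metallic_Delta (a n k : nat) : nat :=
  #|[set u in metallic_words a n | metallic_deg u == k]|.

(* Main.v *)
Require Import Defs.
From mathcomp Require Import all_boot all_order all_algebra.
From mathcomp Require Import zify ring.

Set Implicit Arguments.
Unset Strict Implicit.
Unset Printing Implicit Defensive.

Import Order.TTheory GRing.Theory Num.Theory.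
Local Open Scope ring_scope.

(** The power series sum_(n,k) Delta_(n,k) x^n y^k is the sum of the A_n(y) x^n,
where A_n [degree_poly] sums y^(deg w) over the vertices w of the n-th cube.
So the claim says that A_n satisfies

  A_(n+2) = (2 y + (a-2) y^2) A_(n+1) + (y - y^2 + y^3) A_n

with A_0 = 1 and A_1 = 2 y + (a-2) y^2.

Read a word from the left. A word c :: w has two kinds of neighbors: those
that change the head c, and those that keep c and change the tail w
[degree_after_cons]. Whether the tail is still admissible depends only on
whether the letter before it is 0. For a head c > 0 followed by an admissible
word, c can always go down, and it can go up if c + 1 < a, or if c + 1 = a and
the letter before c is 0 [head_moves_nonzero]. A head 0 can only go up, and it
can do so exactly if the next letter is not a [head_moves0].

Let B_n [degree_poly0] sum y^(deg) over the admissible words of length n + 1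
that start with 0. Splitting on the first letter of the word in A_(n+1), and on
the second letter of the word in B_(n+1), gives [degree_polyS] and
[degree_poly0S]:

  A_(n+1) = B_n + (a-2) y^2 A_n + y A_n,
  B_(n+1) = y B_n + (a-2) y^3 A_n + y^3 A_n + y A_n.

Eliminating B yields the recurrence [degree_polySS]. The terms -y^2 + y^3 come
from the letter a - 1, which has one more move when it follows a 0. *)

(** * Words as paths *)

Lemma big_tuple_cons (R : Type) (idx : R) (op : Monoid.com_law idx)
    (T : finType) (n : nat) (F : n.+1.-tuple T -> R) :
  \big[op/idx]_(w : n.+1.-tuple T) F w =
    \big[op/idx]_(c : T) \big[op/idx]_(w : n.-tuple T) F [tuple of c :: w].
Proof.
rewrite pair_big /=.
rewrite (reindex (fun q : T * n.-tuple T => [tuple of q.1 :: q.2])) //=.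
exists (fun w : n.+1.-tuple T => (thead w, [tuple of behead w])) => w _.
  by case: w => c w; congr (_, _); apply: val_inj.
by rewrite /= -tuple_eta.
Qed.

(** With this relation the admissible words are the paths that start from a
nonzero letter; the letter a, [ord_max], serves as the fictitious letter before
a word. Starting from 0 instead allows the word to begin with a. *)
Definition may_follow (a : nat) : rel 'I_a.+1 :=
  fun p c => (c == a :> nat) ==> (p == 0 :> nat).

Lemma metallic_wordsE (a n : nat) (w : n.-tuple 'I_a.+1) : (0 < a)%N ->
  (w \in metallic_words a n) = path (@may_follow a) ord_max w.
Proof.
move=> a0; rewrite inE; apply/forallP/(pathP ord_max) => [H i|H i].
  rewrite size_tuple => ltin; have := H (Ordinal ltin).
  rewrite /may_follow (tnth_nth ord_max) /=.
  case: (_ == a) => //= /existsP[j /andP[/eqP <-]].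
  by rewrite (tnth_nth ord_max).
apply/implyP => wi; have := H i; rewrite size_tuple ltn_ord => /(_ isT).
rewrite /may_follow -tnth_nth wi /=; case: i wi => -[|i] lti wi /=.
  by rewrite eqn0Ngt a0.
have ltin := ltnW lti.
move=> wj; apply/existsP; exists (Ordinal ltin).
by rewrite eqxx (tnth_nth ord_max).
Qed.

(** * Degrees, one letter at a time *)

Definition neighbor_letters (a : nat) : rel 'I_a.+1 :=
  fun c d => (c == d.+1 :> nat) || (d == c.+1 :> nat).

(** A sum of nonnegative integers is 1 only if one of the head and tail
contributions is 1 and the other 0. *)
Lemma metallic_adj_cons (a n : nat) (c d : 'I_a.+1) (u v : n.-tuple 'I_a.+1) :
  metallic_adj [tuple of c :: u] [tuple of d :: v] =
    (neighbor_letters c d && (u == v)) || ((c == d) && metallic_adj u v).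
Proof.
rewrite /metallic_adj big_ord_recl !tnth0.
under eq_bigr do rewrite !tnthS.
set S := \sum_(i < n) _.
have S0 : (S == 0) = (u == v).
  rewrite psumr_eq0 //; apply/allP/eqP => [H|-> i _]; last by rewrite subrr.
  apply: eq_from_tnth => i; apply: val_inj => /=.
  have := H i (mem_index_enum _) => /=; lia.
have : 0 <= S by apply: sumr_ge0.
rewrite -S0 -val_eqE /neighbor_letters /=; move: S {S0} => S; lia.
Qed.

(** The degree of w among the words that may be written after the letter p. *)
Definition degree_after (a n : nat) (p : 'I_a.+1) (w : n.-tuple 'I_a.+1) :=
  #|[set v : n.-tuple 'I_a.+1 | path (@may_follow a) p v & metallic_adj w v]|.

(** The contribution of the head to the degree of c :: s after p. *)
Definition head_moves (a : nat) (p c : 'I_a.+1) (s : seq 'I_a.+1) :=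
  #|[set d : 'I_a.+1 | neighbor_letters c d & path (@may_follow a) p (d :: s)]|.

(** A neighbor changes either the head or the tail, never both. *)
Lemma degree_after_cons (a n : nat) (p c : 'I_a.+1) (w : n.-tuple 'I_a.+1) :
  may_follow p c ->
  degree_after p [tuple of c :: w] = (head_moves p c w + degree_after c w)%N.
Proof.
move=> pc; rewrite /degree_after /head_moves -!sum1dep_card.
rewrite big_mkcond big_tuple_cons /=.
rewrite [X in (X + _)%N]big_mkcond [X in (_ + X)%N]big_mkcond /=.
(* Changes of the tail are filed under the head d = c, so that both sides are
   sums over the new head d. *)
have -> (G : n.-tuple 'I_a.+1 -> nat) :
    \sum_v G v = \sum_(d : 'I_a.+1) if d == c then \sum_v G v else 0%N.
  by rewrite -big_mkcond big_pred1_eq.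
rewrite -big_split; apply: eq_bigr => d _ /=.
transitivity (\sum_(v : n.-tuple 'I_a.+1) (
  (if v == w then
     if neighbor_letters c d && (may_follow p d && path (@may_follow a) d w)
     then 1 else 0
   else 0)
  + (if d == c then
       if path (@may_follow a) c v && metallic_adj w v then 1 else 0
     else 0)))%N.
  apply: eq_bigr => v _; rewrite metallic_adj_cons [c == d]eq_sym [w == v]eq_sym.
  case: (d =P c) => [->|_].
    have -> : neighbor_letters c c = false by rewrite /neighbor_letters; lia.
    by rewrite pc; case: (v == w).
  rewrite addn0 andFb orbF; case: (v =P w) => [->|_]; last by rewrite !andbF.
  by rewrite andbT andbC.
rewrite big_split -big_mkcond big_pred1_eq; congr (_ + _)%N.
by case: ifP => // _; rewrite big1.
Qed.

Lemma path_same_zero (a : nat) (p q : 'I_a.+1) (s : seq 'I_a.+1) :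
  (p == 0 :> nat) = (q == 0 :> nat) ->
  path (@may_follow a) p s = path (@may_follow a) q s.
Proof. by case: s => //= c s pq; rewrite /may_follow pq. Qed.

Lemma degree_after_same_zero (a n : nat) (p q : 'I_a.+1) (w : n.-tuple 'I_a.+1) :
  (p == 0 :> nat) = (q == 0 :> nat) -> degree_after p w = degree_after q w.
Proof.
by move=> pq; apply: eq_card => v; rewrite !inE (path_same_zero _ pq).
Qed.

Lemma path_after0 (a : nat) (p q : 'I_a.+1) (s : seq 'I_a.+1) :
  p = 0 :> nat -> path (@may_follow a) q s -> path (@may_follow a) p s.
Proof.
by case: s => //= c s p0 /andP[_ ->]; rewrite /may_follow p0 eqxx implybT.
Qed.

(** A head 0 can only become 1. As 1 < a, the 1 is admissible after any p, so
the only condition left is that the tail may follow a nonzero letter. *)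
Lemma head_moves0 (a : nat) (p : 'I_a.+1) (s : seq 'I_a.+1) : (1 < a)%N ->
  head_moves p ord0 s = path (@may_follow a) ord_max s.
Proof.
move=> a1; have lt1 : (1 < a.+1)%N by apply: ltnW.
transitivity #|[set d | (d == Ordinal lt1) && path (@may_follow a) ord_max s]|.
  apply: eq_card => d; rewrite !inE /neighbor_letters /=.
  rewrite -val_eqE /=; case: eqP => // d1.
  rewrite (@path_same_zero _ d ord_max) ?d1 /=; last by lia.
  by rewrite /may_follow d1; case: (_ == a) / eqP => //=; lia.
case: path; last by rewrite -sum1dep_card big1 // => d; rewrite andbF.
by rewrite -[RHS](cards1 (Ordinal lt1)); apply: eq_card => d; rewrite !inE andbT.
Qed.

(** An admissible tail remains so after any letter, so only the new head can
be illegal: moving down never produces the letter a, moving up does when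
c + 1 = a. *)
Lemma head_moves_nonzero (a : nat) (p c : 'I_a.+1) (s : seq 'I_a.+1) :
  (0 < c)%N -> path (@may_follow a) ord_max s ->
  head_moves p c s = (1 + [&& (c < a) & (c.+1 == a) ==> (p == 0 :> nat)])%N.
Proof.
move=> c0 ps; have ca := ltn_ord c.
have ltd : (c.-1 < a.+1)%N by lia.
have path_s (d : 'I_a.+1) : path (@may_follow a) d s.
  case: (posnP d) => [d0|d0]; first exact: path_after0 ps.
  by rewrite (@path_same_zero _ d ord_max) //=; lia.
rewrite /head_moves (cardsD1 (Ordinal ltd)) !inE /= path_s andbT.
have -> : neighbor_letters c (Ordinal ltd) && may_follow p (Ordinal ltd).
  rewrite /neighbor_letters /may_follow /=; lia.
congr (_ + _)%N.
case: ltnP => [lt_ca|le_ac] /=; last first.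
  apply: eq_card0 => d; rewrite !inE -val_eqE /neighbor_letters /=.
  by have := ltn_ord d; lia.
transitivity #|[set d | (d == Ordinal (lt_ca : c.+1 < a.+1)%N)
    && ((c.+1 == a) ==> (p == 0 :> nat))]|.
  apply: eq_card => d; rewrite !inE path_s andbT -!val_eqE /=.
  rewrite /neighbor_letters /may_follow; lia.
case: (_ ==> _); last by rewrite -sum1dep_card big1 // => d; rewrite andbF.
rewrite -[RHS](cards1 (Ordinal (lt_ca : c.+1 < a.+1)%N)).
by apply: eq_card => d; rewrite !inE andbT.
Qed.

(** * Degree polynomials and their recurrence *)

Definition degree_poly (a n : nat) : {poly int} :=
  \sum_(w : n.-tuple 'I_a.+1 | path (@may_follow a) ord_max w)
    'X^(degree_after ord_max w).

(** The degree polynomial of the words 0 :: w: by [head_moves0], the boolean in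
the exponent is the contribution of the leading 0. *)
Definition degree_poly0 (a n : nat) : {poly int} :=
  \sum_(w : n.-tuple 'I_a.+1 | path (@may_follow a) ord0 w)
    'X^(path (@may_follow a) ord_max w + degree_after ord0 w).

Lemma coef_degree_poly (a n k : nat) : (0 < a)%N ->
  (degree_poly a n)`_k = (metallic_Delta a n k)%:Z.
Proof.
move=> a0; rewrite coef_sum /metallic_Delta -sum1dep_card.
rewrite -[RHS]natz natr_sum big_mkcondr /=; apply: eq_big => w.
  by rewrite metallic_wordsE.
move=> _; rewrite coefXn /degree_after /metallic_deg eq_sym.
rewrite (@eq_card _ _ [set v in metallic_words a n | metallic_adj w v]).
  by case: eqP.
by move=> v; rewrite !inE -metallic_wordsE // inE.
Qed.

Lemma degree_after_nil (a : nat) (p : 'I_a.+1) (w : 0.-tuple 'I_a.+1) :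
  degree_after p w = 0%N.
Proof.
apply: eq_card0 => v; rewrite !inE.
by rewrite [X in _ && X]/metallic_adj big_ord0 andbF.
Qed.

Lemma degree_poly_0 (a : nat) : degree_poly a 0 = 1.
Proof.
rewrite /degree_poly (big_pred1 [tuple]) => [|w]; last by rewrite [w]tuple0.
by rewrite degree_after_nil.
Qed.

Lemma degree_poly0_0 (a : nat) : degree_poly0 a 0 = 'X.
Proof.
rewrite /degree_poly0 (big_pred1 [tuple]) => [|w]; last by rewrite [w]tuple0.
by rewrite degree_after_nil.
Qed.

Lemma sum_letters (V : nmodType) (a : nat) (F : 'I_a.+1 -> V) (m l t : V) :
  (1 < a)%N ->
  (forall c : 'I_a.+1, (0 < c < a.-1)%N -> F c = m) ->
  (forall c : 'I_a.+1, c = a.-1 :> nat -> F c = l) ->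
  (forall c : 'I_a.+1, c = a :> nat -> F c = t) ->
  \sum_c F c = F ord0 + m *+ (a - 2) + l + t.
Proof.
case: a F => [|[|b]] // F _ Fm Fl Ft.
rewrite big_ord_recl !big_ord_recr /= !addrA !subSS subn0.
congr (_ + _ + _ + _); [|exact: Fl|exact: Ft].
rewrite (eq_bigr (fun=> m)) => [|i _]; first by rewrite sumr_const card_ord.
by apply: Fm => /=; exact: ltn_ord.
Qed.

(** The extra exponent e counts the moves of a letter 0 standing before c; it is
void in the recurrence for [degree_poly]. *)
Lemma sum_words_nonzero (a n m : nat) (p c : 'I_a.+1)
    (e : n.+1.-tuple 'I_a.+1 -> nat) : (0 < c)%N -> may_follow p c ->
  (forall w : n.-tuple 'I_a.+1, path (@may_follow a) ord_max w ->
     e [tuple of c :: w] = m) ->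
  \sum_(w : n.-tuple 'I_a.+1 | path (@may_follow a) p [tuple of c :: w])
      'X^(e [tuple of c :: w] + degree_after p [tuple of c :: w]) =
    'X^(m + 1 + [&& (c < a) & (c.+1 == a) ==> (p == 0 :> nat)])%N
      * degree_poly a n.
Proof.
move=> c0 pc em; have ca := ltn_ord c.
have c_max : (c == 0 :> nat) = ((ord_max : 'I_a.+1) == 0 :> nat).
  by rewrite /=; lia.
rewrite mulr_sumr; apply: eq_big => [w|w].
  by rewrite /= pc (path_same_zero _ c_max).
rewrite /= pc (path_same_zero _ c_max) /= => wP.
rewrite em // degree_after_cons // (degree_after_same_zero _ c_max).
by rewrite head_moves_nonzero // -exprD !addnA.
Qed.

Lemma sum_words_zero (a n : nat) (p : 'I_a.+1)
    (e : n.+1.-tuple 'I_a.+1 -> nat) : (1 < a)%N ->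
  \sum_(w : n.-tuple 'I_a.+1 | path (@may_follow a) p [tuple of ord0 :: w])
      'X^(e [tuple of ord0 :: w] + degree_after p [tuple of ord0 :: w]) =
  \sum_(w : n.-tuple 'I_a.+1 | path (@may_follow a) ord0 w)
      'X^(e [tuple of ord0 :: w]
          + (path (@may_follow a) ord_max w + degree_after ord0 w)) :> {poly int}.
Proof.
move=> a1; have p0 : may_follow p ord0 by rewrite /may_follow /=; lia.
apply: eq_big => [w|w _]; first by rewrite /= p0.
by rewrite degree_after_cons // head_moves0.
Qed.

Lemma degree_polyS (a n : nat) : (1 < a)%N ->
  degree_poly a n.+1 =
    degree_poly0 a n + (a - 2)%:R * ('X^2 * degree_poly a n)
      + 'X * degree_poly a n.
Proof.
move=> a1; rewrite mulr_natl {1}/degree_poly big_mkcond big_tuple_cons /=.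
rewrite -[RHS]addr0.
under eq_bigr do rewrite -big_mkcond /=.
rewrite (@sum_letters _ _ _ ('X^2 * degree_poly a n) ('X * degree_poly a n) 0) //.
- by rewrite (sum_words_zero _ (fun=> 0%N)).
- move=> c c_mid; rewrite (@sum_words_nonzero _ _ 0 _ _ (fun=> 0%N)) //; try lia.
    by congr ('X^_ * _); rewrite /=; lia.
  by rewrite /may_follow; lia.
- move=> c c_pred; rewrite (@sum_words_nonzero _ _ 0 _ _ (fun=> 0%N)) //; try lia.
    by rewrite -['X in RHS]expr1; congr ('X^_ * _); rewrite /=; lia.
  by rewrite /may_follow; lia.
- move=> c ca; rewrite big_pred0 // => w /=.
  by rewrite {1}/may_follow ca /=; lia.
Qed.

Lemma degree_poly0S (a n : nat) : (1 < a)%N ->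
  degree_poly0 a n.+1 =
    'X * degree_poly0 a n + (a - 2)%:R * ('X^3 * degree_poly a n)
      + 'X^3 * degree_poly a n + 'X * degree_poly a n.
Proof.
move=> a1; rewrite mulr_natl {1}/degree_poly0 big_mkcond big_tuple_cons /=.
under eq_bigr do rewrite -big_mkcond /=.
pose e (w : n.+1.-tuple 'I_a.+1) := path (@may_follow a) ord_max w : nat.
have after0 (c : 'I_a.+1) : may_follow ord0 c by rewrite /may_follow implybT.
have e_small (c : 'I_a.+1) (w : n.-tuple 'I_a.+1) : (0 < c < a)%N ->
    path (@may_follow a) ord_max w -> e [tuple of c :: w] = 1%N.
  move=> c_lt wP; rewrite /e /= (@path_same_zero _ c ord_max) ?wP /=; last by lia.
  by rewrite /may_follow; lia.
rewrite (@sum_letters _ _ _ ('X^3 * degree_poly a n) ('X^3 * degree_poly a n)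
  ('X * degree_poly a n)) //.
- congr (_ + _ + _ + _); rewrite (sum_words_zero _ e) // mulr_sumr.
  apply: eq_bigr => w wP; rewrite -exprS /e /= wP andbT.
  have -> : may_follow (ord_max : 'I_a.+1) ord0 by rewrite /may_follow /=; lia.
  by rewrite add1n.
- move=> c c_mid; rewrite (@sum_words_nonzero _ _ 1 _ _ e) ?after0 //; try lia.
    by congr ('X^_ * _); rewrite /=; lia.
  by move=> w; apply: e_small; lia.
- move=> c c_mid; rewrite (@sum_words_nonzero _ _ 1 _ _ e) ?after0 //; try lia.
    by congr ('X^_ * _); rewrite /=; lia.
  by move=> w; apply: e_small; lia.
- move=> c ca; rewrite (@sum_words_nonzero _ _ 0 _ _ e) ?after0 //; try lia.
    by rewrite -['X in RHS]expr1; congr ('X^_ * _); rewrite /=; lia.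
  by move=> w wP; rewrite /e /= {1}/may_follow ca /=; lia.
Qed.

Lemma degree_polySS (a n : nat) : (1 < a)%N ->
  degree_poly a n.+2 =
    (2%:R * 'X + (a%:R - 2%:R) * 'X^2) * degree_poly a n.+1
      + ('X - 'X^2 + 'X^3) * degree_poly a n.
Proof.
move=> a1; rewrite -natrB // !degree_polyS // degree_poly0S //.
move: ((a - 2)%:R : {poly int}) (degree_poly a n) (degree_poly0 a n) => c A B.
move: 'X => z; ring.
Qed.

(** * Power series with polynomial coefficients *)

Definition fps2_of_polys (P : nat -> {poly int}) : fps2 int :=
  FPS2 (fun n k => (P n)`_k).

Lemma fps2_coef_natM (f : fps2 int) (m n k : nat) :
  fps2_coef (m%:R * f) n k = m%:R * fps2_coef f n k.
Proof.
rewrite !mulr_natl; elim: m => [|m IHm] //.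
by rewrite !mulrS -IHm.
Qed.

Lemma fps2_yM_of_polys (P : nat -> {poly int}) :
  fps2_y * fps2_of_polys P = fps2_of_polys (fun n => 'X * P n).
Proof. by apply: fps2P => n [|k]; rewrite coef_fps2_yM /= coefXM. Qed.

Lemma fps2_xM_of_polys (P : nat -> {poly int}) :
  fps2_x * fps2_of_polys P =
    fps2_of_polys (fun n => if n is m.+1 then P m else 0).
Proof. by apply: fps2P => -[|n] k; rewrite coef_fps2_xM /= ?coef0. Qed.

Lemma fps2_natM_of_polys (m : nat) (P : nat -> {poly int}) :
  m%:R * fps2_of_polys P = fps2_of_polys (fun n => m%:R * P n).
Proof.
by apply: fps2P => n k; rewrite fps2_coef_natM /= !mulr_natl coefMn.
Qed.

Lemma fps2_of_polysD (P Q : nat -> {poly int}) :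
  fps2_of_polys P + fps2_of_polys Q = fps2_of_polys (fun n => P n + Q n).
Proof. by apply: fps2P => n k; rewrite /= coefD. Qed.

Lemma fps2_of_polysN (P : nat -> {poly int}) :
  - fps2_of_polys P = fps2_of_polys (fun n => - P n).
Proof. by apply: fps2P => n k; rewrite /= coefN. Qed.

(** * The generating function *)

Theorem mainTheorem9 (a : nat) (ha : (2 <= a)%N) :
  let x : fps2 int := fps2_x in
  let y : fps2 int := fps2_y in
  FPS2 (fun n k => (metallic_Delta a n k)%:Z) =
    1 / (1 - (2%:R * y + (a%:R - 2%:R) * y ^+ 2) * x
           - (y - y ^+ 2 + y ^+ 3) * x ^+ 2).
Proof.
move=> x y.
have -> : FPS2 (fun n k => (metallic_Delta a n k)%:Z) =
    fps2_of_polys (degree_poly a).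
  by apply: fps2P => n k; rewrite /= coef_degree_poly // ltnW.
set D := (X in 1 / X); set F := fps2_of_polys _.
suff FD : F * D = 1.
  have DU : D \is a GRing.unit by apply: fps2_unitP FD.
  by apply: (mulIr DU); rewrite FD mul1r mulVr.
have -> : F * D = F - (2%:R * (y * (x * F)) + (a%:R - 2%:R) * (y * (y * (x * F))))
    - (y * (x * (x * F)) - y * (y * (x * (x * F))) + y * (y * (y * (x * (x * F))))).
  by rewrite {}/D; move: (a%:R : fps2 int) F x y => c F x y; ring.
rewrite -natrB // /F /x /y.
rewrite !(fps2_xM_of_polys, fps2_yM_of_polys, fps2_natM_of_polys,
  fps2_of_polysN, fps2_of_polysD).
apply: fps2P => n k; transitivity ((n == 0)%:R : {poly int})`_k; last first.
  by case: n => [|n]; rewrite /= ?mulr1n ?mulr0n ?coef1 ?coef0.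
(* The three cases are A_0 = 1, the value of A_1, and the recurrence. *)
congr ((polyseq _)`_k); case: n => [|[|n]] /=.
- by rewrite degree_poly_0; ring.
- rewrite degree_polyS // degree_poly_0 degree_poly0_0.
  by move: ((a - 2)%:R : {poly int}) => c; move: 'X => z; ring.
- rewrite degree_polySS // -natrB //.
  move: ((a - 2)%:R : {poly int}) (degree_poly a n) (degree_poly a n.+1).
  by move=> c A B; move: 'X => z; ring.
Qed.
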